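(* Let $\mu$ be a probability measure on $\mathbb{R}$. For $0<t<1$ and $x\in\mathbb{R}$, let $$d_{t}(x)=\frac{-\log\mu[x-t/2,x+t/2]}{|\log t|}.$$ Then $$\delta_{c}(\mu)=\limsup_{t\to0}\int d_{t}(y)\,d\mu(y).$$
   Context: For $t>0$, let $\nu_t$ be the centered Gaussian law on $\mathbb{R}$ with variance $t^2$, i.e. $\nu_t(dx)=(2\pi t^2)^{-1/2}e^{-x^2/(2t^2)}dx$, and let $\mu_t=\mu*\nu_t$. For a non-negative density $p$, $H(p(x)\,dx)=\int p(x)\log p(x)\,dx$. The classical entropy dimension of a probability measure $\mu$ on $\mathbb{R}$ is $$\delta_c(\mu)=1-\liminf_{t\to0}\frac{H(\mu_t)}{|\log t|}.$$ *)

(* Defs.v *)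
From HB Require Import structures.
From mathcomp Require Import all_boot all_order all_algebra.
From mathcomp Require Import all_classical all_reals all_analysis.
Set Implicit Arguments. Unset Strict Implicit. Unset Printing Implicit Defensive.
Import Order.TTheory GRing.Theory Num.Def Num.Theory.
Import numFieldNormedType.Exports.
Local Open Scope classical_set_scope.
Local Open Scope ring_scope.

Section Defs.
Context {R : realType}.

Definition gauss_density (t x : R) : R :=
  (Num.sqrt (2 * pi * t ^+ 2))^-1 * expR (- (x ^+ 2) / (2 * t ^+ 2)).

(* density of mu_t = mu * nu_t : p_t(x) = \int gauss_t(x - y) dmu(y)
   (the integrand is bounded and nonnegative, so the integral is finite) *)
Definition conv_gauss_density (mu : probability R R) (t x : R) : R :=
  fine (\int[mu]_y (gauss_density t (x - y))%:E)%E.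

Definition entropyH (mu : probability R R) (t : R) : \bar R :=
  (\int[lebesgue_measure]_x
     (conv_gauss_density mu t x * ln (conv_gauss_density mu t x))%:E)%E.

Definition entropy_dim (mu : probability R R) : \bar R :=
  (1 - limf_einf (fun t : R => entropyH mu t * ((`|ln t|)^-1)%:E)
                 (0 : R)^'+)%E.

Definition local_dim (mu : probability R R) (t x : R) : \bar R :=
  let m := mu [set` `[x - t / 2, x + t / 2]] in
  if m == 0%E then +oo%E
  else ((- ln (fine m)) / `|ln t|)%:E.

End Defs.

(* Main.v *)
Require Import Defs.
From HB Require Import structures.
From mathcomp Require Import all_boot all_order all_algebra.
From mathcomp Require Import all_classical all_reals all_analysis.
From mathcomp Require Import measurable_realfun ring lra.
Import Order.TTheory GRing.Theory Num.Def Num.Theory.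
Import numFieldNormedType.Exports.
Local Open Scope classical_set_scope.
Local Open Scope ring_scope.

(** With K the maximum of the Gaussian density g_t, p the density of mu_t and
    m(y) = mu[y - t/2, y + t/2], one has H(mu_t) = log K - B with
    B = \int p log (K / p) in [0, +oo]; put A = \int - log m dmu.  Both entropies
    may be infinite, but A and B differ by at most absolute constants:
    - restricting the integral that defines p(x) to the ball around y gives
      p(x) >= K m(y) exp (- 1/4 - (x - y)^2 / t^2); integrating the logarithm
      against g_t(x - y) dx dmu(y) yields B <= A + C;
    - log u <= u - 1 with u = p(x) / (K m(y)) reduces A <= B + C to
      \int g_t(x - y) / m(y) dmu(y) <= C K, which holds because
      \int_I 1/m dmu <= 1 over every cell I of length t/2 and g_t is summable
      over such cells.
    Dividing by |log t| makes the constants disappear in the limit. *)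

(** * Masses of balls of radius [t / 2] *)

Section Scale.
Context {R : realType}.
Variables (mu : probability R R) (t : R).
Hypothesis t_gt0 : 0 < t.

Let itv y : set R := [set` `[y - t / 2, y + t / 2]].

Definition ball_mass (y : R) : R := fine (mu (itv y)).
(* Since [ln 0 = 0], [logmass] vanishes at the (negligibly many) centers of null balls. *)
Definition logmass (y : R) : R := - ln (ball_mass y).

Lemma in_ballP y z : itv y z <-> `|y - z| <= t / 2.
Proof.
rewrite /itv /= in_itv /= ler_norml; split=> /andP[h1 h2]; apply/andP; split; lra.
Qed.

Lemma ball_massE y : (ball_mass y)%:E = mu (itv y).
Proof.
rewrite /ball_mass fineK// fin_num_measure//; exact: measurable_itv.
Qed.

Lemma ball_mass_ge0 y : 0 <= ball_mass y.
Proof. by rewrite /ball_mass fine_ge0// measure_ge0. Qed.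

Lemma ball_mass_le1 y : ball_mass y <= 1.
Proof. by rewrite -lee_fin ball_massE probability_le1//; exact: measurable_itv. Qed.

Lemma logmass_ge0 y : 0 <= logmass y.
Proof. by rewrite oppr_ge0 ln_le0// ball_mass_le1. Qed.

Lemma expR_logmass y : 0 < ball_mass y -> expR (logmass y) = (ball_mass y)^-1.
Proof. by move=> m0; rewrite expRN lnK. Qed.

(** The balls are the sections of the closed strip [|y - z| <= t / 2] of the plane, and the measure
    of a section depends measurably on its base point. *)
Lemma measurable_ball_mass : measurable_fun setT ball_mass.
Proof.
pose A : set (R * R) := [set z | `|z.1 - z.2| <= t / 2].
have mA : measurable A.
  have -> : A = setT `&` (fun z : R * R => `|z.1 - z.2|) @^-1` `]-oo, t / 2].
    by rewrite setTI; apply/seteqP; split=> z; rewrite /A /= in_itv.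
  have mf : measurable_fun setT (fun z : R * R => `|z.1 - z.2|).
    apply: measurableT_comp; first exact: normr_measurable.
    by apply: measurable_funB; [exact: measurable_fst|exact: measurable_snd].
  by apply: mf => //; exact: measurable_itv.
have H := measurable_fun_xsection mu mA.
apply/measurable_EFinP; apply: eq_measurable_fun H => y _ /=.
rewrite ball_massE; congr (mu _); apply/seteqP; split=> z.
  by rewrite /xsection /= inE => /in_ballP.
by move/in_ballP; rewrite /xsection /= inE.
Qed.

Lemma measurable_logmass : measurable_fun setT logmass.
Proof.
apply: measurable_funN; apply: measurableT_comp; first exact: measurable_ln.
exact: measurable_ball_mass.
Qed.

Lemma measurable_ball_mass_eq0 : measurable [set y | ball_mass y = 0].
Proof.
by have := measurable_ball_mass measurableT [set 0] (measurable_set1 0); rewrite setTI.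
Qed.

(** * Sets of diameter at most [t / 2] *)

Section Cell.
Variable A : set R.
Hypothesis mA : measurable A.
Hypothesis diamA : forall y z, A y -> A z -> `|y - z| <= t / 2.

Lemma le_ball_mass y : A y -> (mu A <= (ball_mass y)%:E)%E.
Proof.
move=> Ay; rewrite ball_massE le_measure ?inE//; first exact: measurable_itv.
by move=> z Az; apply/in_ballP; exact: diamA.
Qed.

(** If [mu A] is positive, the integrand on [A] is [1 / ball_mass], which is at most [1 / mu A]
    because the ball around any point of [A] contains [A]. A null cell contributes zero. *)
Lemma integral_cell_expR_logmass : (\int[mu]_(y in A) (expR (logmass y))%:E <= 1)%E.
Proof.
have mE D : measurable D -> measurable_fun D (fun y => (expR (logmass y))%:E).
  move=> mD; apply/measurable_EFinP; apply: measurableT_comp; first exact: measurable_expR.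
  by apply: measurable_funTS; exact: measurable_logmass.
have [A0|A0] := eqVneq (mu A) 0%E.
  have := @integral_abs_eq0 _ _ _ mu A (fun y => (expR (logmass y))%:E) mA (mE _ mA) A0.
  rewrite (eq_integral (fun y => (expR (logmass y))%:E)) => [->//|y _].
  by rewrite gee0_abs// lee_fin expR_ge0.
have Af : mu A \is a fin_num by exact: fin_num_measure.
have Agt0 : 0 < fine (mu A) by rewrite fine_gt0// lt0e A0 measure_ge0 ltey_eq Af.
apply: (@le_trans _ _ (\int[mu]_(y in A) (cst (fine (mu A))^-1%:E) y)%E).
  apply: ge0_le_integral => //.
  - exact: mE.
  move=> y Ay /=; have := le_ball_mass y Ay.
  rewrite -[mu A]fineK// lee_fin => le_m.
  by rewrite lee_fin expR_logmass ?lef_pV2 ?posrE// (lt_le_trans Agt0).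
rewrite integral_cst//= -[X in (_ * X)%E]fineK// -EFinM mulVf//; lra.
Qed.

(** If [mu A] is positive, every ball centred in [A] has at least that mass, so the intersection is
    empty. *)
Lemma cell_null : mu (A `&` [set y | ball_mass y = 0]) = 0%E.
Proof.
have [A0|/eqP A0] := eqVneq (mu A) 0%E; last first.
  rewrite [X in mu X](_ : _ = set0) ?measure0//.
  rewrite -subset0 => y /= [Ay m0]; apply: A0; apply/eqP.
  by rewrite eq_le measure_ge0 andbT (le_trans (le_ball_mass y Ay))// m0.
apply/eqP; rewrite eq_le measure_ge0 andbT -A0 le_measure ?inE//.
apply: measurableI => //; exact: measurable_ball_mass_eq0.
Qed.

End Cell.

(** Cells are indexed by their distance [k t / 2] to [x], so that the decay of a Gaussian centred at
    [x] can be read off from [k]. Neighbours share an endpoint; this is harmless, since cells only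
    serve to cover and to bound from above. *)
Definition rcell (x : R) (k : nat) : set R :=
  [set` `[x + k%:R * (t / 2), x + k.+1%:R * (t / 2)]].
Definition lcell (x : R) (k : nat) : set R :=
  [set` `[x - k.+1%:R * (t / 2), x - k%:R * (t / 2)]].

Lemma diam_rcell x k y z : rcell x k y -> rcell x k z -> `|y - z| <= t / 2.
Proof.
rewrite /rcell /= !in_itv /= -(natr1 k) mulrDl mul1r => /andP[? ?] /andP[? ?].
rewrite ler_norml; apply/andP; split; lra.
Qed.

Lemma diam_lcell x k y z : lcell x k y -> lcell x k z -> `|y - z| <= t / 2.
Proof.
rewrite /lcell /= !in_itv /= -(natr1 k) mulrDl mul1r => /andP[? ?] /andP[? ?].
rewrite ler_norml; apply/andP; split; lra.
Qed.

Lemma measurable_rcell x k : measurable (rcell x k).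
Proof. exact: measurable_itv. Qed.

Lemma measurable_lcell x k : measurable (lcell x k).
Proof. exact: measurable_itv. Qed.

(** The index is the integer part of [|y - x| / (t / 2)], and the sign of [y - x] selects the
    side. *)
Lemma cell_cover x y : exists k, rcell x k y \/ lcell x k y.
Proof.
have t2 : 0 < t / 2 by rewrite divr_gt0.
have /truncn_itv : 0 <= `|y - x| / (t / 2) by rewrite divr_ge0// ltW.
set k := truncn _; rewrite ler_pdivlMr// ltr_pdivrMr// -(natr1 k) mulrDl mul1r => /andP[h1 h2].
exists k; rewrite /rcell /lcell /= !in_itv /= -(natr1 k) mulrDl mul1r.
by have [xy|xy] := lerP 0 (y - x); move: h1 h2;
  [rewrite ger0_norm// => h1 h2; left | rewrite ltr0_norm// => h1 h2; right];
  apply/andP; split; lra.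
Qed.

(** Countably many cells cover the line, and each meets the set of centres of null balls in a null
    set. *)
Lemma ae_ball_mass_gt0 : {ae mu, forall y, 0 < ball_mass y}.
Proof.
pose Z := [set y | ball_mass y = 0].
have mZ : measurable Z.
  exact: measurable_ball_mass_eq0.
have : mu.-negligible (\bigcup_k ((rcell 0 k `&` Z) `|` (lcell 0 k `&` Z))).
  apply: negligible_bigcup => k; apply: negligibleU.
    exists (rcell 0 k `&` Z); split => //.
      by apply: measurableI => //; exact: measurable_rcell.
    by apply: cell_null; [exact: measurable_rcell|exact: diam_rcell].
  exists (lcell 0 k `&` Z); split => //.
    by apply: measurableI => //; exact: measurable_lcell.
  by apply: cell_null; [exact: measurable_lcell|exact: diam_lcell].
apply: negligibleS => y /= /negP; rewrite -leNgt => m0.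
have Zy : Z y by apply/eqP; rewrite eq_le m0 ball_mass_ge0.
by have [k [?|?]] := cell_cover 0 y; exists k => //; [left|right].
Qed.

End Scale.

(** * The Gaussian density and its second moment *)

Section Gauss.
Context {R : realType}.
Implicit Types t u x y : R.
Local Notation leb := (@lebesgue_measure R).

Definition gauss_peak t : R := (Num.sqrt (2 * pi * t ^+ 2))^-1.

Lemma gauss_densityE t u :
  gauss_density t u = gauss_peak t * expR (- (u ^+ 2 / (2 * t ^+ 2))).
Proof. by rewrite /gauss_density mulNr. Qed.

Lemma gauss_peak_gt0 t : 0 < t -> 0 < gauss_peak t.
Proof. by move=> t0; rewrite invr_gt0 sqrtr_gt0 !mulr_gt0// ?pi_gt0// exprn_gt0. Qed.

Lemma gauss_density_gt0 t u : 0 < t -> 0 < gauss_density t u.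
Proof. by move=> t0; rewrite mulr_gt0 ?expR_gt0//; exact: gauss_peak_gt0. Qed.

Lemma gauss_density_le t u : 0 < t -> gauss_density t u <= gauss_peak t.
Proof.
move=> t0; rewrite gauss_densityE ler_piMr ?(ltW (gauss_peak_gt0 _ t0))//.
rewrite -expR0 ler_expR oppr_le0 divr_ge0 ?sqr_ge0// mulr_ge0 ?sqr_ge0//.
Qed.

Lemma measurable_gauss_density t : measurable_fun setT (gauss_density t).
Proof.
apply: measurable_funM => //; apply: measurableT_comp => //.
apply: measurable_funM => //; exact: measurable_funN.
Qed.

Lemma gauss_density_normal_pdf t x y : 0 < t -> gauss_density t (x - y) = normal_pdf y t x.
Proof.
move=> t0; rewrite normal_pdfE ?gt_eqF// /gauss_density /normal_peak /normal_fun.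
by congr ((Num.sqrt _)^-1 * expR (_ / _)); rewrite -mulr_natl//; ring.
Qed.

Lemma integral_gauss_density t y : 0 < t ->
  (\int[leb]_x (gauss_density t (x - y))%:E = 1)%E.
Proof.
move=> t0; rewrite -(integral_normal_pdf y t).
by apply: eq_integral => x _; rewrite gauss_density_normal_pdf.
Qed.

(** With [v = u^2 / (4 t^2)] the left side is [4 v] times the peak times [exp (- 2 v)]. One factor
    [exp (- v)] absorbs [v]; the other is the Gaussian shape at scale [sqrt 2 t], whose peak is
    smaller by [sqrt 2]. This bounds the second moment without computing it. *)
Lemma sqr_gauss_density_le t u : 0 < t ->
  u ^+ 2 / t ^+ 2 * gauss_density t u <= 4 * Num.sqrt 2 * gauss_density (Num.sqrt 2 * t) u.
Proof.
move=> t0; have s0 : 0 < Num.sqrt 2 :> R by rewrite sqrtr_gt0.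
have t2 : 0 < t ^+ 2 by rewrite exprn_gt0.
have pk : gauss_peak t = Num.sqrt 2 * gauss_peak (Num.sqrt 2 * t).
  rewrite /gauss_peak exprMn sqr_sqrtr//.
  have -> : 2 * pi * (2 * t ^+ 2) = 2 * (2 * pi * t ^+ 2) :> R by ring.
  by rewrite (sqrtrM (2 * pi * t ^+ 2))// invfM mulVKf// gt_eqF.
rewrite !gauss_densityE exprMn sqr_sqrtr// pk.
set v := u ^+ 2 / (2 * (2 * t ^+ 2)).
have -> : u ^+ 2 / t ^+ 2 = 4 * v by rewrite /v; field; rewrite gt_eqF.
have -> : u ^+ 2 / (2 * t ^+ 2) = v + v by rewrite /v; field; rewrite gt_eqF.
rewrite opprD expRD.
have ve : v * expR (- v) <= 1.
  rewrite expRN ler_pdivrMr ?expR_gt0// mul1r (le_trans _ (expR_ge1Dx v))//; lra.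
have c0 : 0 <= 4 * (Num.sqrt 2 * gauss_peak (Num.sqrt 2 * t)) * expR (- v).
  by rewrite !mulr_ge0 ?expR_ge0 ?ltW// gauss_peak_gt0// mulr_gt0.
have := ler_wpM2l c0 ve; rewrite mulr1 => H.
by apply: etrans H; congr (_ <= _); ring.
Qed.

Lemma integral_sqr_gauss_density t y : 0 < t ->
  (\int[leb]_x ((x - y) ^+ 2 / t ^+ 2 * gauss_density t (x - y))%:E <= (4 * Num.sqrt 2)%:E)%E.
Proof.
move=> t0; have s0 : 0 < Num.sqrt 2 :> R by rewrite sqrtr_gt0.
have mB : measurable_fun setT (fun x : R => x - y) by exact: measurable_funB.
have st0 : 0 < Num.sqrt 2 * t by rewrite mulr_gt0.
apply: (@le_trans _ _
  (\int[leb]_x ((4 * Num.sqrt 2)%:E * (gauss_density (Num.sqrt 2 * t) (x - y))%:E))%E).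
  apply: ge0_le_integral => //.
  - move=> x _; rewrite lee_fin mulr_ge0//; last exact/ltW/gauss_density_gt0.
    by rewrite divr_ge0// sqr_ge0.
  - apply/measurable_EFinP; apply: measurable_funM.
      by apply: measurable_funM => //; exact: measurable_funX.
    by apply: measurableT_comp => //; exact: measurable_gauss_density.
  - apply/measurable_EFinP; apply: measurable_funM => //.
    by apply: measurableT_comp => //; exact: measurable_gauss_density.
  by move=> x _; rewrite -EFinM lee_fin sqr_gauss_density_le.
rewrite ge0_integralZl_EFin//.
- by rewrite integral_gauss_density// mule1.
- by move=> x _; rewrite lee_fin; exact/ltW/gauss_density_gt0.
- by apply/measurable_EFinP; apply: measurableT_comp => //; exact: measurable_gauss_density.
Qed.

End Gauss.

(** * The density of the smoothed measure *)

Section Density.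
Context {R : realType}.
Variables (mu : probability R R) (t : R).
Hypothesis t_gt0 : 0 < t.
Local Notation leb := (@lebesgue_measure R).
Local Notation g := (gauss_density t).
Local Notation K := (gauss_peak t).
Local Notation p := (conv_gauss_density mu t).

Lemma integral_cst_probability (c : \bar R) : (\int[mu]_y cst c y)%E = c.
Proof. by rewrite integral_cst// [X in (_ * X)%E](probability_setT mu) mule1. Qed.

Lemma measurable_gauss_densityB y : measurable_fun setT (fun x : R => g (x - y)).
Proof.
apply: measurableT_comp; first exact: measurable_gauss_density.
exact: measurable_funB.
Qed.

Lemma measurable_gauss_densityBr x : measurable_fun setT (fun y : R => g (x - y)).
Proof.
apply: measurableT_comp; first exact: measurable_gauss_density.
exact: measurable_funB.
Qed.

Lemma measurable_gauss_density2 :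
  measurable_fun setT (fun z : measurableTypeR R * R => g (z.1 - z.2)).
Proof.
apply: measurableT_comp; first exact: measurable_gauss_density.
by apply: measurable_funB; [exact: measurable_fst|exact: measurable_snd].
Qed.

Lemma integral_gauss_density_le x : (\int[mu]_y (g (x - y))%:E <= K%:E)%E.
Proof.
apply: (@le_trans _ _ (\int[mu]_y (cst K%:E) y)%E).
  apply: ge0_le_integral => //.
  - by move=> y _; rewrite lee_fin; exact/ltW/gauss_density_gt0.
  - by apply/measurable_EFinP; exact: measurable_gauss_densityBr.
  - by move=> y _; rewrite lee_fin; exact: gauss_density_le.
by rewrite integral_cst_probability.
Qed.

Lemma conv_gauss_densityE x : (p x)%:E = (\int[mu]_y (g (x - y))%:E)%E.
Proof.
rewrite /conv_gauss_density fineK// ge0_fin_numE.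
  by apply: le_lt_trans (integral_gauss_density_le x) _; rewrite ltry.
by apply: integral_ge0 => y _; rewrite lee_fin; exact/ltW/gauss_density_gt0.
Qed.

Lemma conv_gauss_density_le x : p x <= K.
Proof. by rewrite -lee_fin conv_gauss_densityE integral_gauss_density_le. Qed.

Lemma measurable_conv_gauss_density : measurable_fun setT p.
Proof.
apply/measurable_EFinP; apply: (eq_measurable_fun (fubini_F mu
    (fun z : measurableTypeR R * R => (g (z.1 - z.2))%:E))).
  by move=> x _; rewrite /fubini_F /= conv_gauss_densityE.
apply: measurable_fun_fubini_tonelli_F.
- by apply/measurable_EFinP; exact: measurable_gauss_density2.
- by move=> z; rewrite lee_fin; exact/ltW/gauss_density_gt0.
Qed.

(** Tonelli, as [p x] is itself an integral over [mu]; nonnegativity of [f] suffices, so infinite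
    values and infinite integrals are covered. *)
Lemma integral_conv_gauss_density (f : R -> \bar R) :
  measurable_fun setT f -> (forall x, 0 <= f x)%E ->
  (\int[leb]_x ((p x)%:E * f x) = \int[mu]_y \int[leb]_x ((g (x - y))%:E * f x))%E.
Proof.
move=> mf f0.
rewrite -(fubini_tonelli (m1 := leb) (m2 := mu)
  (fun z : measurableTypeR R * R => ((g (z.1 - z.2))%:E * f z.1)%E)) /=.
- apply: eq_integral => x _; rewrite ge0_integralZr//.
  + by rewrite conv_gauss_densityE.
  + by apply/measurable_EFinP; exact: measurable_gauss_densityBr.
  + by move=> y _; rewrite lee_fin; exact/ltW/gauss_density_gt0.
- apply: emeasurable_funM; first by apply/measurable_EFinP; exact: measurable_gauss_density2.
  by apply: (measurableT_comp mf); exact: measurable_fst.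
- by move=> z; rewrite mule_ge0// lee_fin; exact/ltW/gauss_density_gt0.
Qed.

Lemma ball_le_conv_gauss_density x y :
  ball_mass mu t y * (K * expR (- (4^-1 + (x - y) ^+ 2 / t ^+ 2))) <= p x.
Proof.
pose I : set R := [set` `[y - t / 2, y + t / 2]].
have mI : measurable I by exact: measurable_itv.
rewrite -lee_fin conv_gauss_densityE mulrC EFinM ball_massE -integral_cst//.
apply: (@le_trans _ _ (\int[mu]_(z in I) (g (x - z))%:E)%E).
  apply: ge0_le_integral => //.
  - by move=> z _; rewrite lee_fin mulr_ge0 ?expR_ge0// ltW// gauss_peak_gt0.
  - by apply: measurable_funTS; apply/measurable_EFinP; exact: measurable_gauss_densityBr.
  move=> z /in_ballP zy; rewrite lee_fin gauss_densityE ler_wpM2l// ?ler_expR ?lerN2.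
    by rewrite ltW// gauss_peak_gt0.
  have t2 : 0 < t ^+ 2 by rewrite exprn_gt0.
  rewrite ler_pdivrMr ?mulr_gt0//.
  have -> : (4^-1 + (x - y) ^+ 2 / t ^+ 2) * (2 * t ^+ 2) = t ^+ 2 / 2 + 2 * (x - y) ^+ 2.
    by field; rewrite gt_eqF.
  have yz2 : (y - z) ^+ 2 <= (t / 2) ^+ 2.
    by rewrite -real_normK ?num_real// lerXn2r ?nnegrE// divr_ge0// ltW.
  (* This square is the slack in [(x - z)^2 <= 2 (x - y)^2 + 2 (y - z)^2]; the bound
     [(y - z)^2 <= t^2 / 4] on the ball produces the constant [1/4]. *)
  have := sqr_ge0 ((x - y) - (y - z)); move: yz2; rewrite !expr2; lra.
apply: ge0_subset_integral => //.
- by apply/measurable_EFinP; exact: measurable_gauss_densityBr.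
- by move=> z _; rewrite lee_fin; exact/ltW/gauss_density_gt0.
Qed.

(** Some ball has positive mass, since otherwise the whole line would be [mu]-null; the lower bound
    centred there is positive at every [x]. *)
Lemma conv_gauss_density_gt0 x : 0 < p x.
Proof.
have [y m0] : exists y, 0 < ball_mass mu t y.
  apply/not_existsP => H; have := ae_ball_mass_gt0 mu t t_gt0.
  move=> [A [mA A0 sA]]; have : mu setT = 0%E.
    apply/eqP; rewrite eq_le measure_ge0 andbT -A0 le_measure ?inE//.
    by apply: subset_trans sA => y _ /=; exact: H.
  by rewrite probability_setT => /eqP; rewrite gt_eqF// lte_fin.
apply: lt_le_trans (ball_le_conv_gauss_density x y).
by rewrite !mulr_gt0 ?expR_gt0 ?gauss_peak_gt0.
Qed.

Lemma integral_conv_gauss_density1 : (\int[leb]_x (p x)%:E = 1)%E.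
Proof.
under eq_integral => x _ do rewrite -[(p x)%:E]mule1.
rewrite (integral_conv_gauss_density (cst 1%E))//.
rewrite -[RHS](integral_cst_probability 1%E).
apply: eq_integral => y _ /=; rewrite -[RHS](integral_gauss_density t y t_gt0).
by apply: eq_integral => x _; rewrite /= mule1.
Qed.

End Density.

(** * Upper bound for A in terms of B *)

Lemma nneseries_geometric_le (R : realType) (a z : R) : 0 <= a -> 0 < z -> z < 1 ->
  (\sum_(0 <= k <oo) (geometric a z k)%:E <= (a / (1 - z))%:E)%E.
Proof.
move=> a0 z0 z1; apply: lime_le.
  by apply: is_cvg_nneseries => k _ _; rewrite lee_fin geometric_ge0// ltW.
apply: nearW => n; rewrite sumEFin lee_fin.
by apply: geometric_le_lim => //; rewrite gtr0_norm.
Qed.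

Section Comparison.
Context {R : realType}.
Variables (mu : probability R R) (t : R).
Hypothesis t_gt0 : 0 < t.
Local Notation leb := (@lebesgue_measure R).
Local Notation g := (gauss_density t).
Local Notation K := (gauss_peak t).
Local Notation p := (conv_gauss_density mu t).
Local Notation l := (logmass mu t).

(** Sum of the geometric series with first term [exp (1/8)] and ratio [exp (- 1/4)], doubled for the
    two sides of [x]. *)
Definition cell_const : R := 2 * (expR 8^-1 / (1 - expR (- 4^-1))).

(* [k ^ 2 / 8 >= (2 k - 1) / 8] makes the Gaussian tail geometric *)
Lemma gauss_density_cell_le x y (k : nat) : rcell t x k y \/ lcell t x k y ->
  g (x - y) <= geometric (K * expR 8^-1) (expR (- 4^-1)) k.
Proof.
have K0 := gauss_peak_gt0 _ t_gt0.
have t2 : 0 < t ^+ 2 by rewrite exprn_gt0.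
move=> cy; rewrite gauss_densityE /= -[leRHS]mulrA ler_wpM2l ?(ltW K0)//.
rewrite -expRM_natl -expRD ler_expR.
have h : k%:R * (t / 2) <= `|x - y|.
  move: cy; rewrite /rcell /lcell /= !in_itv /= => -[] /andP[h1 h2].
    by rewrite distrC; apply: le_trans (ler_norm _); lra.
  by apply: le_trans (ler_norm _); lra.
have h2 : (k%:R * (t / 2)) ^+ 2 <= (x - y) ^+ 2.
  rewrite -[leRHS]real_normK ?num_real// lerXn2r ?nnegrE//.
  by rewrite mulr_ge0// divr_ge0// ltW.
rewrite lerNl opprD mulrN opprK ler_pdivlMr ?mulr_gt0//.
have := mulr_ge0 (ltW t2) (sqr_ge0 (k%:R - 1 : R)); move: h2.
rewrite !expr2; lra.
Qed.

Lemma measurable_expR_logmass : measurable_fun setT (fun y => (expR (l y))%:E).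
Proof.
apply/measurable_EFinP; apply: measurableT_comp => //; exact: measurable_logmass.
Qed.

(** On the two cells of index [k] the Gaussian is at most the geometric term [c k], and each cell
    contributes at most 1 to the integral of [expR (l y)]. Summing [2 c k] gives a bound uniform in
    [x]. *)
Lemma integral_gauss_div_mass x :
  (\int[mu]_y (g (x - y) * expR (l y))%:E <= (K * cell_const)%:E)%E.
Proof.
have K0 := gauss_peak_gt0 _ t_gt0.
pose c := geometric (K * expR 8^-1) (expR (- 4^-1) : R).
have c0 k : 0 <= c k by rewrite geometric_ge0 ?mulr_ge0 ?expR_ge0 ?ltW.
pose E y := (expR (l y))%:E.
have E0 y : (0 <= E y)%E by rewrite lee_fin expR_ge0.
have mE := measurable_expR_logmass.
pose F k y := ((c k)%:E * ((E \_ (rcell t x k)) y + (E \_ (lcell t x k)) y))%E.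
have r0 (A : set R) y : (0 <= (E \_ A) y)%E by exact: erestrict_ge0.
have F0 k y : (0 <= F k y)%E by rewrite mule_ge0 ?lee_fin// adde_ge0.
have mr (A : set R) : measurable A -> measurable_fun setT (E \_ A).
  by move=> mA; apply/(measurable_restrictT _ mA); exact: measurable_funTS.
have mrc k := measurable_rcell t x k.
have mlc k := measurable_lcell t x k.
have mF k : measurable_fun setT (F k).
  by apply: measurable_funeM; apply: emeasurable_funD; exact: mr.
apply: (@le_trans _ _ (\int[mu]_y \sum_(0 <= k <oo) F k y)%E).
  apply: ge0_le_integral => //.
  - by move=> y _; rewrite lee_fin mulr_ge0 ?expR_ge0 ?ltW ?gauss_density_gt0.
  - apply/measurable_EFinP; apply: measurable_funM; first exact: measurable_gauss_densityBr.
    by apply/measurable_EFinP.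
  - by apply: ge0_emeasurable_sum.
  (* One cell containing [y] is enough: its term alone dominates the integrand. *)
  move=> y _; have [k ky] := cell_cover t t_gt0 x y.
  apply: (@le_trans _ _ (F k y)).
    rewrite EFinM /F; apply: lee_pmul; rewrite ?lee_fin ?expR_ge0//.
    - by rewrite ltW ?gauss_density_gt0.
    - exact: gauss_density_cell_le.
    case: ky => ky.
      by rewrite [leLHS](_ : _ = (E \_ (rcell t x k)) y) ?leeDl// patchE mem_set.
    by rewrite [leLHS](_ : _ = (E \_ (lcell t x k)) y) ?leeDr// patchE mem_set.
  (* The partial sum of length [k.+1] is the first that contains the term of index [k]. *)
  apply: le_trans (nneseries_lim_ge k.+1 _) => //.
  by rewrite big_nat_recr//= leeDr// sume_ge0.
rewrite integral_nneseries//.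
apply: (@le_trans _ _
  (\sum_(0 <= k <oo) (geometric (K * expR 8^-1 * 2) (expR (- 4^-1)) k)%:E)%E).
  apply: lee_nneseries => k; first by move=> _ _; exact: integral_ge0.
  rewrite /F ge0_integralZl_EFin//; last 2 first.
  - by move=> y _; rewrite adde_ge0.
  - by apply: emeasurable_funD; exact: mr.
  move=> _; rewrite (_ : geometric (K * expR 8^-1 * 2) _ k = c k * 2); last first.
    by rewrite /c /= mulrAC.
  rewrite (EFinM (c k) 2); apply: lee_wpmul2l; first by rewrite lee_fin.
  rewrite ge0_integralD//; [|exact: mr|exact: mr].
  rewrite -!integral_mkcond (_ : 2%:E = 1 + 1)%E; last by rewrite -EFinD.
  apply: leeD; apply: integral_cell_expR_logmass => //.
  - by move=> y z; exact: diam_rcell.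
  - by move=> y z; exact: diam_lcell.
apply: le_trans (nneseries_geometric_le _ _ _ _ _ _) _; rewrite ?expR_gt0//.
- by rewrite !mulr_ge0 ?expR_ge0 ?ltW.
by rewrite lee_fin le_eqVlt; apply/orP; left; apply/eqP; rewrite /cell_const; ring.
Qed.

(** This is [log (K / p)]. Unlike [ln (p x)] it has a constant sign, because [p <= K], so Tonelli
    applies even when the entropy is infinite. *)
Definition gap (x : R) : R := ln K - ln (p x).

Lemma gap_ge0 x : 0 <= gap x.
Proof.
rewrite subr_ge0 ler_ln ?posrE ?gauss_peak_gt0 ?conv_gauss_density_gt0//.
exact: conv_gauss_density_le.
Qed.

Lemma measurable_gap : measurable_fun setT gap.
Proof.
apply: measurable_funB => //; apply: (measurableT_comp (f := @ln R)); first exact: measurable_ln.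
exact: measurable_conv_gauss_density.
Qed.

Local Notation A := (\int[mu]_y (l y)%:E)%E.
Local Notation B := (\int[leb]_x ((p x)%:E * (gap x)%:E))%E.

(* [ln u <= u - 1] with [u = p x / (K m y)] *)
Lemma logmass_le_gap x y : l y <= gap x + K^-1 * (p x * expR (l y)).
Proof.
have K0 := gauss_peak_gt0 _ t_gt0; have p0 := conv_gauss_density_gt0 mu t t_gt0 x.
have v0 : 0 < p x * expR (l y) by apply: mulr_gt0 => //; exact: expR_gt0.
have k0 : 0 < K^-1 by rewrite invr_gt0.
have := ln_sublinear (mulr_gt0 k0 v0).
rewrite lnM ?posrE// lnM ?posrE ?expR_gt0// lnV ?posrE// expRK /gap; lra.
Qed.

(** Logarithm of the lower bound on [p] obtained from the ball around [y], which is informative only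
    when that ball has positive mass. *)
Lemma gap_le_logmass x y : 0 < ball_mass mu t y ->
  gap x <= l y + 4^-1 + (x - y) ^+ 2 / t ^+ 2.
Proof.
move=> m0; have K0 := gauss_peak_gt0 _ t_gt0.
have := ball_le_conv_gauss_density mu t t_gt0 x y.
set e := expR _; have e0 : 0 < e by exact: expR_gt0.
have Ke0 : 0 < K * e by exact: mulr_gt0.
rewrite -ler_ln ?posrE; [|exact: mulr_gt0|exact: conv_gauss_density_gt0].
rewrite lnM ?posrE// lnM ?posrE// /e expRK /gap /logmass; lra.
Qed.

(** The bound of [logmass_le_gap] is integrated against the probability [g (x - y) dx dmu(y)]: by
    Tonelli its first term yields B, and its second is controlled by [integral_gauss_div_mass]. *)
Lemma integral_logmass_le : (A <= B + cell_const%:E)%E.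
Proof.
have K0 := gauss_peak_gt0 _ t_gt0.
have g0 x y : 0 <= g (x - y) by rewrite ltW ?gauss_density_gt0.
have p0 x : 0 <= p x by rewrite ltW ?conv_gauss_density_gt0.
have mg y := measurable_gauss_densityB t y.
have mgap := measurable_gap.
have mp : measurable_fun setT p by exact: measurable_conv_gauss_density.
have ml := measurable_logmass mu t.
have mgl x : measurable_fun setT (fun y : R => g (x - y) * expR (l y)).
  apply: measurable_funM; first exact: measurable_gauss_densityBr.
  by apply: measurableT_comp.
pose F1 (z : measurableTypeR R * R) := ((g (z.1 - z.2))%:E * (gap z.1)%:E)%E.
pose F2 (z : measurableTypeR R * R) :=
  (K^-1 * p z.1 * (g (z.1 - z.2) * expR (l z.2)))%:E.
have F10 z : (0 <= F1 z)%E by rewrite mule_ge0 ?lee_fin// gap_ge0.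
have F20 z : (0 <= F2 z)%E by rewrite lee_fin !mulr_ge0 ?expR_ge0// invr_ge0 ltW.
have mF1 : measurable_fun setT F1.
  apply: emeasurable_funM; apply/measurable_EFinP; first exact: measurable_gauss_density2.
  by apply: (measurableT_comp mgap); exact: measurable_fst.
have mF2 : measurable_fun setT F2.
  apply/measurable_EFinP; apply: measurable_funM.
    by apply: measurable_funM => //; apply: (measurableT_comp mp); exact: measurable_fst.
  apply: measurable_funM; first exact: measurable_gauss_density2.
  by apply: measurableT_comp => //; apply: (measurableT_comp ml); exact: measurable_snd.
have mF12 (F : measurableTypeR R * R -> \bar R) y : measurable_fun setT F ->
    measurable_fun setT (fun x : measurableTypeR R => F (x, y)).
  by move=> mF; apply: (measurableT_comp mF); exact: measurable_pair2.
apply: (@le_trans _ _ (\int[mu]_y (\int[leb]_x F1 (x, y) + \int[leb]_x F2 (x, y)))%E).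
  apply: ge0_le_integral => //.
  - by move=> y _; rewrite lee_fin logmass_ge0.
  - by apply/measurable_EFinP.
  - by apply: emeasurable_funD; exact: measurable_fun_fubini_tonelli_G.
  move=> y _; rewrite -ge0_integralD//; [|exact: mF12|exact: mF12].
  (* As [g (x - y)] has integral one in [x], the constant [l y] becomes an integral over [x], to be
     compared pointwise. *)
  rewrite -[leLHS]mule1 -(integral_gauss_density t y t_gt0) -ge0_integralZl_EFin//.
  - apply: ge0_le_integral => //.
    + by move=> x _; rewrite -EFinM lee_fin mulr_ge0 ?logmass_ge0.
    + apply: measurable_funeM; apply/measurable_EFinP; exact: mg.
    + by apply: emeasurable_funD; exact: mF12.
    move=> x _; rewrite /F1 /F2 /= -!EFinM -EFinD lee_fin.
    have := ler_wpM2l (g0 x y) (logmass_le_gap x y); lra.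
  - by move=> x _; rewrite lee_fin.
  - by apply/measurable_EFinP; exact: mg.
  - exact: logmass_ge0.
rewrite ge0_integralD//; last 4 first.
- by move=> y _; exact: integral_ge0.
- exact: measurable_fun_fubini_tonelli_G.
- by move=> y _; exact: integral_ge0.
- exact: measurable_fun_fubini_tonelli_G.
rewrite integral_conv_gauss_density//; last 2 first.
- by apply/measurable_EFinP.
- by move=> x; rewrite lee_fin gap_ge0.
apply: leeD => //.
(* Integrating over [mu] first gives at most [K * cell_const]; [K] cancels, and [cell_const * p]
   remains, where [p] has total mass one. *)
rewrite -(fubini_tonelli (m1 := leb) (m2 := mu) F2)//.
apply: (@le_trans _ _ (\int[leb]_x ((cell_const)%:E * (p x)%:E))%E).
  apply: ge0_le_integral => //.
  - by move=> x _; exact: integral_ge0.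
  - exact: measurable_fun_fubini_tonelli_F.
  - by apply: measurable_funeM; apply/measurable_EFinP.
  move=> x _; rewrite /F2 /=; under eq_integral => y _ do rewrite EFinM.
  rewrite ge0_integralZl_EFin//; last 3 first.
  - by move=> y _; rewrite lee_fin mulr_ge0 ?expR_ge0.
  - by apply/measurable_EFinP.
  - by rewrite mulr_ge0// invr_ge0 ltW.
  apply: le_trans (lee_wpmul2l _ (integral_gauss_div_mass x)) _.
    by rewrite lee_fin mulr_ge0// invr_ge0 ltW.
  rewrite -!EFinM lee_fin mulrACA mulVf ?gt_eqF// mul1r mulrC//.
have C0 : 0 <= cell_const.
  by rewrite /cell_const mulr_ge0// divr_ge0 ?expR_ge0// subr_ge0.
rewrite ge0_integralZl_EFin//.
- by rewrite integral_conv_gauss_density1// mule1.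
- by move=> x _; rewrite lee_fin.
- by apply/measurable_EFinP.
Qed.

End Comparison.

(** * Entropy formula, upper bound for B in terms of A, and the integral of the local dimension *)

Lemma integralB_ge0 (R : realType) d (T : measurableType d)
    (nu : {measure set T -> \bar R}) (f h : T -> R) :
  nu.-integrable setT (EFin \o f) -> measurable_fun setT h -> (forall x, 0 <= h x) ->
  (\int[nu]_x (f x - h x)%:E = \int[nu]_x (f x)%:E - \int[nu]_x (h x)%:E)%E.
Proof.
move=> fi mh h0.
have [mf foo] := integrableP _ _ _ fi.
have mf' : measurable_fun setT f by apply/measurable_EFinP.
have habs : (\int[nu]_x `|(h x)%:E| = \int[nu]_x (h x)%:E)%E.
  by apply: eq_integral => x _; rewrite gee0_abs// lee_fin.
(* For [h] of finite integral this is ordinary linearity; otherwise both sides are shown to be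
   [-oo]. *)
have [hoo|hoo] := ltP (\int[nu]_x (h x)%:E)%E +oo%E.
  under eq_integral => x _ do rewrite EFinB.
  rewrite integralB_EFin//; apply/integrableP; split; first by apply/measurable_EFinP.
  by rewrite habs.
have {}hoo : (\int[nu]_x (h x)%:E = +oo)%E by apply/eqP; rewrite -leye_eq.
rewrite hoo addeNy.
pose F x := (f x - h x)%:E.
have mF : measurable_fun setT F by apply/measurable_EFinP; exact: measurable_funB.
rewrite (integralE _ _ F).
have Fp : (\int[nu]_x F^\+ x < +oo)%E.
  apply: le_lt_trans foo; apply: ge0_le_integral => //.
  - exact: measurable_funepos.
  - exact: measurableT_comp.
  move=> x _; rewrite funeposE /F /= -EFin_max lee_fin ge_max normr_ge0 andbT.
  by apply: le_trans (ler_norm _); rewrite lerBlDr lerDl.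
have Fn : (\int[nu]_x F^\- x = +oo)%E.
  apply/eqP; rewrite -leye_eq -hoo.
  (* Since [h <= |f| + F^\-] and [|f|] has finite integral, the negative part must have infinite
     integral. *)
  have H : (\int[nu]_x (h x)%:E <= \int[nu]_x `|(f x)%:E| + \int[nu]_x F^\- x)%E.
    rewrite -ge0_integralD//; last 2 first.
    - exact: measurableT_comp.
    - exact: measurable_funeneg.
    apply: ge0_le_integral => //.
    - by move=> x _; rewrite lee_fin.
    - by apply/measurable_EFinP.
    - by apply: emeasurable_funD; [exact: measurableT_comp|exact: measurable_funeneg].
    move=> x _; rewrite funenegE /F /= -EFin_max -EFinD lee_fin.
    have := ler_norm (f x).
    have : - (f x - h x) <= Num.max (- (f x - h x)) 0 by rewrite le_max lexx.
    lra.
  move: H; rewrite hoo; move: foo; case: (\int[nu]_x `|_|)%E => // r _.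
  by case: (\int[nu]_x F^\- x)%E.
by rewrite Fn addeNy.
Qed.

Section Entropy.
Context {R : realType}.
Variables (mu : probability R R) (t : R).
Hypothesis t_gt0 : 0 < t.
Local Notation leb := (@lebesgue_measure R).
Local Notation g := (gauss_density t).
Local Notation K := (gauss_peak t).
Local Notation p := (conv_gauss_density mu t).
Local Notation l := (logmass mu t).

Local Notation h := (gap mu t).
Local Notation A := (\int[mu]_y (l y)%:E)%E.
Local Notation B := (\int[leb]_x ((p x)%:E * (h x)%:E))%E.

(** The bound of [gap_le_logmass] is integrated against [g (x - y) dx dmu(y)]; the quadratic term
    costs at most [4 sqrt 2] by the second moment estimate. *)
Lemma integral_gap_le : (B <= A + (4^-1 + 4 * Num.sqrt 2)%:E)%E.
Proof.
have K0 := gauss_peak_gt0 _ t_gt0.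
have g0 x y : 0 <= g (x - y) by rewrite ltW ?gauss_density_gt0.
have gap0 x : 0 <= h x by exact: gap_ge0.
have mg y := measurable_gauss_densityB t y.
have mgap : measurable_fun setT h by exact: measurable_gap.
have ml := measurable_logmass mu t.
have l0 y : 0 <= l y by exact: logmass_ge0.
have c0 : 0 <= 4^-1 + 4 * Num.sqrt 2 :> R by rewrite addr_ge0// mulr_ge0.
rewrite integral_conv_gauss_density//; last by apply/measurable_EFinP.
(* The constant is moved under the integral over [mu], so that it remains to compare integrands in
   [y]. *)
rewrite -[X in (_ + X)%E](integral_cst_probability mu) -ge0_integralD//; last 2 first.
- by move=> y _; rewrite lee_fin.
- by apply/measurable_EFinP.
apply: ae_ge0_le_integral => //.
- by move=> y _; apply: integral_ge0 => x _; rewrite mule_ge0// lee_fin.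
- pose F1 (z : measurableTypeR R * R) := ((g (z.1 - z.2))%:E * (h z.1)%:E)%E.
  apply: (@measurable_fun_fubini_tonelli_G _ _ (measurableTypeR R) R R leb F1).
    apply: emeasurable_funM; apply/measurable_EFinP; first exact: measurable_gauss_density2.
    by apply: (measurableT_comp mgap); exact: measurable_fst.
  by move=> z; rewrite mule_ge0// lee_fin.
- by move=> y _; rewrite adde_ge0// lee_fin.
- by apply: emeasurable_funD => //; apply/measurable_EFinP.
(* The pointwise bound on the gap is available at centres of balls of positive mass, hence for
   almost every [y]. *)
have := ae_ball_mass_gt0 mu t t_gt0; apply: filterS => y m0 _ /=.
have lc0 : 0 <= l y + 4^-1 by rewrite addr_ge0.
have mq : measurable_fun setT (fun x : R => (x - y) ^+ 2 / t ^+ 2 * g (x - y)).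
  apply: measurable_funM; last exact: mg.
  by apply: measurable_funM => //; apply: measurable_funX; exact: measurable_funB.
have q0 x : 0 <= (x - y) ^+ 2 / t ^+ 2 * g (x - y).
  by rewrite mulr_ge0// divr_ge0// sqr_ge0.
apply: (@le_trans _ _ (\int[leb]_x ((l y + 4^-1)%:E * (g (x - y))%:E +
    ((x - y) ^+ 2 / t ^+ 2 * g (x - y))%:E))%E).
  apply: ge0_le_integral => //.
  - by move=> x _; rewrite mule_ge0// lee_fin.
  - by apply: emeasurable_funM; apply/measurable_EFinP; [exact: mg|exact: mgap].
  - apply: emeasurable_funD; last by apply/measurable_EFinP; exact: mq.
    by apply: measurable_funeM; apply/measurable_EFinP; exact: mg.
  move=> x _; rewrite -!EFinM -EFinD lee_fin.
  have := ler_wpM2l (g0 x y) (gap_le_logmass mu t t_gt0 x y m0); lra.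
rewrite ge0_integralD//; last 4 first.
- by move=> x _; rewrite mule_ge0// lee_fin.
- by apply: measurable_funeM; apply/measurable_EFinP; exact: mg.
- by move=> x _; rewrite lee_fin.
- by apply/measurable_EFinP; exact: mq.
rewrite ge0_integralZl_EFin//; last 2 first.
- by move=> x _; rewrite lee_fin.
- by apply/measurable_EFinP; exact: mg.
rewrite integral_gauss_density// mule1 EFinD -addeA leeD2l// EFinD leeD2l//.
exact: integral_sqr_gauss_density.
Qed.

(** Pointwise [p log p = p log K - p gap], and [p] has integral one; [integralB_ge0] also covers an
    infinite B, where the entropy is [-oo]. *)
Lemma entropyHE : entropyH mu t = ((ln K)%:E - B)%E.
Proof.
have mp : measurable_fun setT p by exact: measurable_conv_gauss_density.
have mgap : measurable_fun setT h by exact: measurable_gap.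
have p0 x : 0 <= p x by rewrite ltW ?conv_gauss_density_gt0.
have p1 := integral_conv_gauss_density1 mu t t_gt0.
have pint : leb.-integrable setT (EFin \o p).
  apply/integrableP; split; first by apply/measurable_EFinP.
  rewrite [ltLHS](_ : _ = 1%E) ?ltry// -[RHS]p1; apply: eq_integral => x _.
  by rewrite /= ger0_norm.
have Kint : leb.-integrable setT (EFin \o (fun x => ln K * p x)).
  by have := integrableZl measurableT (ln K) pint.
transitivity (\int[leb]_x (ln K * p x - p x * h x)%:E)%E.
  by apply: eq_integral => x _; congr EFin; rewrite /gap; ring.
rewrite integralB_ge0//.
- congr (_ - _)%E; under eq_integral => x _ do rewrite EFinM.
  by rewrite integralZl// p1 mule1.
- exact: measurable_funM.
- by move=> x; rewrite mulr_ge0// gap_ge0.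
Qed.

(** The integrands differ only at centres of null balls, where [local_dim] is [+oo] and [logmass] is
    0; these form a null set. *)
Lemma integral_local_dim :
  (\int[mu]_y local_dim mu t y = A * (`|ln t|^-1)%:E)%E.
Proof.
have ml := measurable_logmass mu t.
rewrite -ge0_integralZr//; last 2 first.
- by apply/measurable_EFinP.
- by move=> y _; rewrite lee_fin logmass_ge0.
have locE y : local_dim mu t y =
    if ball_mass mu t y == 0 then +oo%E else (l y * `|ln t|^-1)%:E.
  by rewrite /local_dim -ball_massE eqe.
apply: ge0_ae_eq_integral => //.
- apply: (eq_measurable_fun (fun y =>
      if ball_mass mu t y == 0 then +oo%E else (l y * `|ln t|^-1)%:E)).
    by move=> y _; rewrite locE.
  apply: measurable_fun_ifT => //.
    apply: (measurable_fun_bool true); rewrite setTI.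
    have -> : (fun y => ball_mass mu t y == 0) @^-1` [set true] =
        [set y | ball_mass mu t y = 0].
      by apply/seteqP; split=> y /= /eqP.
    exact: measurable_ball_mass_eq0.
  by apply/measurable_EFinP; exact: measurable_funM.
- by apply/measurable_EFinP; exact: measurable_funM.
- move=> y _; rewrite locE; case: ifP => // _.
  by rewrite lee_fin mulr_ge0 ?logmass_ge0// invr_ge0.
- by move=> y _; rewrite lee_fin mulr_ge0 ?logmass_ge0// invr_ge0.
have := ae_ball_mass_gt0 mu t t_gt0; apply: filterS => y m0 _ /=.
by rewrite locE gt_eqF.
Qed.

End Entropy.

(** * Passage to the upper limit as the scale tends to 0 *)

Lemma limf_esup_le_shift (R : realType) (F : set_system R) (FF : Filter F)
    (f h : R -> \bar R) (r : R) :
  (forall e : R, 0 < e -> \forall x \near F, (f x <= h x + (r + e)%:E)%E) ->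
  (limf_esup f F <= limf_esup h F + r%:E)%E.
Proof.
move=> fh; apply/lee_addgt0Pr => e e0.
rewrite -addeA -EFinD -leeBlDr// [leRHS]limf_esupE.
apply: le_ereal_inf_tmp => _ [V FV <-]; rewrite leeBlDr//.
(* Any [V] competing in the infimum for [h] is shrunk to the points where the bound holds; this set
   competes in the infimum for [f]. *)
pose W := V `&` [set x | (f x <= h x + (r + e)%:E)%E].
have FW : F W by exact: filterI FV (fh _ e0).
rewrite limf_esupE; apply: (le_trans (ereal_inf_lbound _)); first by exists W.
apply: ge_ereal_sup => _ [x [Vx fx] <-]; apply: le_trans fx _.
by rewrite leeD2r//; apply: ereal_sup_ubound; exists x.
Qed.

Section Comparison.
Context {R : realType} (mu : probability R R).
Local Notation H t := (entropyH mu t * (`|ln t|^-1)%:E)%E.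
Local Notation D t := (\int[mu]_y local_dim mu t y)%E.

(** For [t < 1] the term [- ln t] is [|log t|]; divided by [|log t|] it becomes the 1 in the
    definition of the entropy dimension. *)
Lemma ln_gauss_peak (t : R) : 0 < t ->
  ln (gauss_peak t) = - ln t - ln (Num.sqrt (2 * pi)).
Proof.
move=> t0; have s0 : 0 < Num.sqrt (2 * pi) :> R by rewrite sqrtr_gt0 mulr_gt0// pi_gt0.
rewrite /gauss_peak sqrtrM ?mulr_ge0 ?pi_ge0// sqrtr_sqr gtr0_norm//.
by rewrite lnV ?posrE ?mulr_gt0// lnM ?posrE//; ring.
Qed.

Lemma near_le_div_ln (c e : R) : 0 < e -> \forall t \near 0^'+, c / `|ln t| <= e.
Proof.
move=> e0; near=> t.
have t0 : 0 < t by near: t; exact: nbhs_right_gt.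
have t1 : t < 1 by near: t; exact: nbhs_right_lt.
have lt0 : ln t < 0 by rewrite ln_lt0// t0.
rewrite ltr0_norm// ler_pdivrMr ?oppr_gt0// mulrN lerNr mulrC -ler_pdivlMr//; apply: ltW.
(* The threshold is [t < exp (- c / e)]. *)
by rewrite -ltr_expR lnK ?posrE//; near: t; exact: nbhs_right_lt (expR_gt0 _).
Unshelve. all: by end_near. Qed.

(** By the entropy formula [- H t = (B + k) / |ln t| - 1], so the two comparisons of A and B hold
    after division with errors [(C2 + k) / |ln t|] and [(C1 - k) / |ln t|], both eventually below
    [e]. *)
Lemma near_entropy_local_dim (e : R) : 0 < e -> \forall t \near 0^'+,
  (- H t <= D t + (-1 + e)%:E)%E /\ (D t <= - H t + (1 + e)%:E)%E.
Proof.
pose k := ln (Num.sqrt (2 * pi)) : R.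
pose C1 := cell_const : R; pose C2 := 4^-1 + 4 * Num.sqrt 2 : R.
move=> e0; near=> t.
have t0 : 0 < t by near: t; exact: nbhs_right_gt.
have t1 : t < 1 by near: t; exact: nbhs_right_lt.
have lt0 : 0 < `|ln t| by rewrite normr_gt0 lt_eqF// ln_lt0// t0.
have ltE : `|ln t| = - ln t by rewrite ltr0_norm// ln_lt0// t0.
have h1 : (C1 - k) / `|ln t| <= e by near: t; exact: near_le_div_ln.
have h2 : (C2 + k) / `|ln t| <= e by near: t; exact: near_le_div_ln.
rewrite integral_local_dim// entropyHE// ln_gauss_peak// -ltE.
have := integral_logmass_le mu t t0; have := integral_gap_le mu t t0.
have : (0 <= \int[mu]_y (logmass mu t y)%:E)%E.
  by apply: integral_ge0 => y _; rewrite lee_fin logmass_ge0.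
have : (0 <= \int[lebesgue_measure]_x
    ((conv_gauss_density mu t x)%:E * (gap mu t x)%:E))%E.
  apply: integral_ge0 => x _; rewrite -EFinM lee_fin mulr_ge0 ?gap_ge0// ltW//.
  exact: conv_gauss_density_gt0.
move: (\int[mu]_y _)%E (\int[lebesgue_measure]_x _)%E => a b.
move: h1 h2 lt0; rewrite -/k -/C1 -/C2; set L := `|ln t| => h1 h2 lt0.
have iL : 0 < L^-1 by rewrite invr_gt0.
(* Each of A and B is at most the other plus a constant, so they are finite together; if both are
   infinite, [- H t] and [D t] are both [+oo]. *)
case: a => [a| |]; case: b => [b| |] //= _ _ hb ha; last first.
  by rewrite !gt0_mulNye ?gt0_mulye ?lte_fin.
move: ha hb; rewrite -!EFinD !lee_fin => hb ha.
have e1 : - ((L - k - b) * L^-1) = (b + k) / L - 1 by field; rewrite gt_eqF.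
rewrite e1.
have h3 : (b + k) / L <= a / L + (C2 + k) / L by rewrite -mulrDl ler_pM2r//; lra.
have h4 : a / L <= (b + k) / L + (C1 - k) / L by rewrite -mulrDl ler_pM2r//; lra.
split; lra.
Unshelve. all: by end_near. Qed.

End Comparison.

Theorem theorem3p1 (R : realType) (mu : probability R R) :
  entropy_dim mu =
  limf_esup (fun t : R => (\int[mu]_y local_dim mu t y)%E) (0 : R)^'+.
Proof.
(* The lower limit is minus the upper limit of the opposite, so the left side is 1 plus the upper
   limit of [- H t]; the two inequalities use the shifts [-1] and [1]. *)
rewrite /entropy_dim /limf_einf oppeK; apply/eqP; rewrite eq_le; apply/andP; split.
  rewrite addeC -leeBrDr//; apply: limf_esup_le_shift => e e0.
  by apply: filterS (near_entropy_local_dim mu e e0) => t [].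
rewrite addeC; apply: limf_esup_le_shift => e e0.
by apply: filterS (near_entropy_local_dim mu e e0) => t [].
Qed.
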